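(* Let $S$ be a reduced commutative semigroup with $0$. The following are equivalent: (1) $\chi(S)$ is finite; (2) $\omega(S)$ is finite (i.e. $\Gamma(S)$ does not contain an infinite clique); (3) the zero ideal $\{0\}$ of $S$ is a finite intersection of prime ideals of $S$.
   Context: A commutative semigroup with $0$ is a commutative semigroup $S$ with an element $0$ such that $0s=0$ for all $s\in S$. A zero-divisor is an element $x\in S$ with $xy=0$ for some $y\in S$, $y\neq 0$; $Z(S)$ is the set of zero-divisors. The zero-divisor graph $\Gamma(S)$ is the simple undirected graph with vertex set $Z(S)\setminus\{0\}$, where distinct $x,y$ are adjacent iff $xy=0$. $S$ is reduced if for all $x\in S$ and $n\ge 1$, $x^n=0$ implies $x=0$. A non-empty subset $I\subseteq S$ is an ideal if $xS\subseteq I$ for every $x\in I$; an ideal $\mathfrak p$ is prime if for all $x,y\in S$, $xSy\subseteq\mathfrak p$ implies $x\in\mathfrak p$ or $y\in\mathfrak p$. $\chi(S)$ denotes the chromatic number of $\Gamma(S)$ (the minimum number of colors in a coloring assigning distinct colors to adjacent vertices), and $\omega(S)$ denotes the clique number of $\Gamma(S)$ (the number of vertices of a largest complete subgraph). *)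

(* Defs.v *)
From HB Require Import structures.
From mathcomp Require Import all_boot all_classical.

Set Implicit Arguments.
Unset Strict Implicit.
Unset Printing Implicit Defensive.

Local Open Scope classical_set_scope.
Local Open Scope card_scope.
Local Open Scope group_scope.

HB.mixin Record Semigroup_isComSemigroup0 S of Semigroup S := {
  szero : S;
  smulC : commutative (@mul S);
  smul0 : left_zero szero (@mul S)
}.

#[short(type="comSemigroup0Type")]
HB.structure Definition ComSemigroup0 :=
  {S of Semigroup_isComSemigroup0 S & Semigroup S}.

Bind Scope group_scope with ComSemigroup0.sort.

Notation "0" := szero : group_scope.

Section Graphs.
Variables (T : Type) (V : set T) (E : T -> T -> Prop).

Definition is_coloring (n : nat) (c : T -> nat) : Prop :=
  (forall x, V x -> (c x < n)%N) /\
  (forall x y, V x -> V y -> E x y -> c x <> c y).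

Definition is_chromatic_number (n : nat) : Prop :=
  (exists c, is_coloring n c) /\
  (forall m c, is_coloring m c -> (n <= m)%N).

Definition is_clique (C : set T) : Prop :=
  C `<=` V /\ (forall x y, C x -> C y -> x <> y -> E x y).

(* The second clause also ranges over infinite cliques, so it excludes them. *)
Definition is_clique_number (n : nat) : Prop :=
  (exists2 C, is_clique C & C #= `I_n) /\
  (forall C, is_clique C -> C #<= `I_n).

End Graphs.

Section Semigroups.
Variable S : comSemigroup0Type.

Definition zero_divisors : set S := [set x | exists2 y, y <> 0 & x * y = 0].

Definition zdg_vertices : set S := zero_divisors `\ 0.

Definition zdg_adj (x y : S) : Prop := x <> y /\ x * y = 0.

(* There is no unit, hence no zeroth power: [iter n (mul x) x] is x^(n+1). *)
Definition reduced : Prop :=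
  forall (x : S) (n : nat), iter n (mul x) x = 0 -> x = 0.

Definition ideal (I : set S) : Prop :=
  I !=set0 /\ (forall x s, I x -> I (x * s)).

(* A prime ideal is not required to be proper. *)
Definition prime_ideal (p : set S) : Prop :=
  ideal p /\ (forall x y, (forall s, p (x * s * y)) -> p x \/ p y).

Definition chi_finite : Prop :=
  exists n, is_chromatic_number zdg_vertices zdg_adj n.

Definition omega_finite : Prop :=
  exists n, is_clique_number zdg_vertices zdg_adj n.

Definition no_infinite_clique : Prop :=
  ~ exists2 C, is_clique zdg_vertices zdg_adj C & infinite_set C.

(* For the empty family the intersection is the whole of S; it is {0} only when
   S = {0}, in which case {0} is itself a prime ideal. *)
Definition zero_finite_cap_primes : Prop :=
  exists F : set (set S),
    [/\ finite_set F, F `<=` prime_ideal & \bigcap_(p in F) p = [set 0]].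

End Semigroups.

(* Main.v *)
(** If the graph is coloured with [n] colours, cliques have at most [n] elements.
If [{0}] is a finite intersection of primes, colour [x <> 0] by the first prime
of the family missing [x]: two vertices of the same colour have nonzero product.

The remaining implication follows Beck.  Without infinite cliques every
annihilator [ann y], [y <> 0], lies in a maximal one: otherwise choose
[ann x_0 < ann x_1 < ...] and [a_i] in [ann x_(i+1)] but not in [ann x_i]; the
products [a_i x_i] form an infinite clique.  As [S] is reduced, maximal
annihilators are prime, generators of distinct ones multiply to [0] (so there
are finitely many), and they intersect in [0]. *)

Require Import Defs.
From mathcomp Require Import all_boot all_classical.

Set Implicit Arguments.
Unset Strict Implicit.
Unset Printing Implicit Defensive.

Local Open Scope classical_set_scope.
Local Open Scope card_scope.
Local Open Scope group_scope.

Section GraphNumbers.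
Variables (T : Type) (V : set T) (E : T -> T -> Prop).

(** A colouring is injective on a clique and takes only values below [n] there. *)
Lemma clique_card_le_coloring (n : nat) (c : T -> nat) (C : set T) :
  is_coloring V E n c -> is_clique V E C -> C #<= `I_n.
Proof.
move=> [c_lt c_neq] [CV Cadj].
have c_inj : {in C &, injective c}.
  move=> x y; rewrite !inE => Cx Cy cxy; apply: contrapT => xy.
  exact: (c_neq _ _ (CV _ Cx) (CV _ Cy) (Cadj _ _ Cx Cy xy)).
rewrite -(card_le_eql (inj_card_eq c_inj)); apply: subset_card_le.
by move=> _ [x Cx <-]; exact/c_lt/CV.
Qed.

(** The bound makes every clique finite, so the largest size attained is the clique number; the
    empty clique shows that some size is attained. *)
Lemma clique_number_exists (n : nat) :
  (forall C, is_clique V E C -> C #<= `I_n) ->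
  exists m, is_clique_number V E m.
Proof.
move=> bound.
pose P k := `[< exists2 C, is_clique V E C & C #= `I_k >].
have exP : exists k, P k.
  exists 0%N; apply/asboolP; exists set0; first by split=> // x y [].
  by rewrite II0 card_eq0 eqxx.
have leP k : P k -> (k <= n)%N.
  by move=> /asboolP[C /bound Cn Ck]; rewrite -card_le_II -(card_le_eql Ck).
have [m /asboolP Pm max_m] := ex_maxnP exP leP.
exists m; split=> // C cliqueC.
have /finite_setP[k Ck] : finite_set C.
  exact: card_le_finite (bound _ cliqueC) (finite_II n).
rewrite (card_le_eql Ck) card_le_II; apply: max_m.
by apply/asboolP; exists C.
Qed.

Lemma chromatic_number_exists (n : nat) (c : T -> nat) :
  is_coloring V E n c -> exists m, is_chromatic_number V E m.
Proof.
move=> colc; pose P k := `[< exists c, is_coloring V E k c >].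
have exP : exists k, P k by exists n; apply/asboolP; exists c.
have [m /asboolP Pm min_m] := ex_minnP exP.
exists m; split=> // k c' colc'; apply: min_m.
by apply/asboolP; exists c'.
Qed.

End GraphNumbers.

Section Annihilators.
Variable S : comSemigroup0Type.
Hypothesis S_reduced : reduced S.
Implicit Types x y z : S.

Lemma muls0 x : x * 0 = 0.
Proof. by rewrite smulC smul0. Qed.

Lemma square_eq0 x : x * x = 0 -> x = 0.
Proof. by move=> xx; apply: (S_reduced (n := 1%N)). Qed.

Definition ann x : set S := [set y | x * y = 0].

(** Only nonzero elements compete, since [ann 0] is all of [S]. *)
Definition max_ann x : Prop :=
  x <> 0 /\ forall y, y <> 0 -> ann x `<=` ann y -> ann y = ann x.

Lemma ann_subMl x y : ann x `<=` ann (x * y).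
Proof. by move=> z xz; rewrite /ann /= (smulC x) -mulgA xz muls0. Qed.

Lemma ann_subMr x y : ann y `<=` ann (x * y).
Proof. by rewrite smulC; exact: ann_subMl. Qed.

Lemma ann_ideal x : ideal (ann x).
Proof.
split; first by exists 0; exact: muls0.
by move=> y s xy; rewrite /ann /= mulgA xy smul0.
Qed.

(** If [x * a <> 0], maximality gives [ann (x * a) = ann x], so it suffices that [x * a * b], or by
    reducedness its square, vanishes. *)
Lemma max_ann_prime x : max_ann x -> prime_ideal (ann x).
Proof.
move=> [x0 xmax]; split; first exact: ann_ideal.
move=> a b xasb; have [xa|xa] := pselect (ann x a); first by left.
right; rewrite -(xmax _ xa (@ann_subMl x a)); apply: square_eq0.
(* The choice [s := x] kills the factor [x * (a * x * b)] of the square. *)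
have := xasb x; rewrite /ann /= => xaxb.
have -> : x * a * b * (x * a * b) = x * (a * x * b) * (a * b).
  by rewrite -!mulgA; congr (x * (a * _)); rewrite mulgA (smulC b) -!mulgA.
by rewrite xaxb smul0.
Qed.

(** If [x * y <> 0], then [ann (x * y)] contains both annihilators, hence equals both. *)
Lemma max_ann_mul_eq0 x y :
  max_ann x -> max_ann y -> ann x <> ann y -> x * y = 0.
Proof.
move=> [_ xmax] [_ ymax] neq_ann; apply: contrapT => xy0; apply: neq_ann.
by rewrite -(xmax _ xy0 (@ann_subMl x y)) (ymax _ xy0 (@ann_subMr x y)).
Qed.

Lemma orthogonal_family_infinite_clique (z : nat -> S) :
  (forall i, z i <> 0) -> (forall i j, (i < j)%N -> z i * z j = 0) ->
  ~ no_infinite_clique S.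
Proof.
move=> z0 zz; have zz_neq i j : i <> j -> z i * z j = 0.
  move=> /eqP; rewrite neq_ltn => /orP[|]; first exact: zz.
  by rewrite smulC; exact: zz.
apply; exists (range z).
  split.
    move=> _ [i _ <-]; split; last exact: z0.
    by exists (z i.+1); [exact: z0 | exact: zz].
  move=> _ _ [i _ <-] [j _ <-] neq_z; split=> //.
  by apply: zz_neq => ij; apply: neq_z; rewrite ij.
(* A repeated value would have square zero, hence be zero. *)
have z_inj : {in [set: nat] &, injective z}.
  move=> i j _ _ zij; apply: contrapT => /zz_neq.
  by rewrite zij => /square_eq0/z0.
rewrite (eq_finite_set (inj_card_eq z_inj)); exact: infinite_nat.
Qed.

Lemma max_ann_exists y : no_infinite_clique S -> y <> 0 ->
  exists2 x, max_ann x & ann y `<=` ann x.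
Proof.
move=> noinf y0; apply: contrapT => nomax.
pose P x := x <> 0 /\ ann y `<=` ann x.
(* The premise [P x] sits under the existential so that choice yields a function on all of [S],
   ready to be iterated. *)
have step x : exists x', P x -> [/\ P x', ann x `<=` ann x' & ann x' <> ann x].
  have [[x0 yx]|nPx] := pselect (P x); last by exists x.
  apply: contrapT => nostep; apply: nomax; exists x => //; split=> // z z0 xz.
  apply: contrapT => neq_ann; apply: nostep; exists z => _.
  by split=> //; split=> //; exact: subset_trans xz.
have [f fP] := choice step.
pose x_ i := iter i f y.
have Px i : P (x_ i) by elim: i => [|i /fP[]] //; split.
have mono i j : (i <= j)%N -> ann (x_ i) `<=` ann (x_ j).
  move=> /subnK <-; elim: (j - i)%N => //= k; move/subset_trans; apply.
  by have [_] := fP _ (Px (k + i)%N).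
have /choice[a aP] i : exists a, ann (x_ i.+1) a /\ ~ ann (x_ i) a.
  have [_ sub neq] := fP _ (Px i); apply: contrapT => noa; apply: neq.
  apply/seteqP; split=> // a xa; apply: contrapT => nxa; apply: noa.
  by exists a.
apply: (@orthogonal_family_infinite_clique (fun i => x_ i * a i)) noinf.
  by move=> i; have [] := aP i.
(* The chain increases, so [a i], which lies in [ann (x_ i.+1)], also lies in [ann (x_ j)]. *)
move=> i j ij; have xjai : x_ j * a i = 0 by have [/(mono _ _ ij)] := aP i.
by rewrite -mulgA (mulgA (a i)) (smulC (a i)) xjai smul0 muls0.
Qed.

Lemma finite_max_ann : no_infinite_clique S -> finite_set (ann @` max_ann).
Proof.
move=> noinf; apply: contrapT => infM; apply: noinf.
have /choice[g gP] (p : set S) :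
    exists x, (ann @` max_ann) p -> max_ann x /\ ann x = p.
  have [[x mx <-]|np] := pselect ((ann @` max_ann) p); first by exists x.
  by exists 0 => /np.
have g_inj : {in ann @` max_ann &, injective g}.
  move=> p q; rewrite !inE => /gP[_ gp] /gP[_ gq] gpq.
  by rewrite -gp -gq gpq.
have gg p q : (ann @` max_ann) p -> (ann @` max_ann) q -> p <> q ->
    g p * g q = 0.
  move=> /gP[mp gp] /gP[mq gq] pq.
  by apply: max_ann_mul_eq0 => //; rewrite gp gq.
exists (g @` (ann @` max_ann)); last first.
  by rewrite (eq_finite_set (inj_card_eq g_inj)).
split.
  move=> _ [p Mp <-]; have [[gp0 _] _] := gP _ Mp; split=> //.
  (* A second maximal annihilator [q] supplies the nonzero [g q] showing that [g p] is a
     zero-divisor. *)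
  have [q [Mq qp]] := infinite_setN0 (infinite_setD infM (finite_set1 p)).
  have [[gq0 _] _] := gP _ Mq.
  by exists (g q) => //; apply: gg => // pq; apply: qp.
move=> _ _ [p Mp <-] [q Mq <-] neq_g; split=> //.
by apply: gg => // pq; apply: neq_g; rewrite pq.
Qed.

Lemma zero_cap_max_ann :
  no_infinite_clique S -> \bigcap_(p in ann @` max_ann) p = [set 0].
Proof.
move=> noinf; apply/seteqP; split; last first.
  by move=> _ -> _ [x _ <-]; exact: muls0.
move=> y capy; apply: contrapT => y0.
have [x mx yx] := max_ann_exists noinf y0.
have xy : x * y = 0 by have := capy (ann x); apply; exists x.
(* As [x] lies in [ann y], it lies in [ann x]. *)
have xx : x * x = 0 by apply: yx; rewrite /ann /= smulC.
by case: mx => x0 _; exact/x0/square_eq0.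
Qed.

Lemma no_infinite_clique_cap_primes :
  no_infinite_clique S -> zero_finite_cap_primes S.
Proof.
move=> noinf; exists (ann @` max_ann); split.
- exact: finite_max_ann.
- by move=> _ [x mx <-]; exact: max_ann_prime.
- exact: zero_cap_max_ann.
Qed.

End Annihilators.

Section Implications.
Variable S : comSemigroup0Type.

Lemma cap_primes_chi_finite : zero_finite_cap_primes S -> chi_finite S.
Proof.
move=> [_ [/finite_seqP[s ->] primes cap0]].
pose miss x (p : set S) := ~~ `[< p x >].
have has_miss x : x <> 0 -> has (miss x) s.
  move=> x0; apply: contrapT => /negP/hasPn allx; apply: x0.
  suff : [set 0] x by [].
  by rewrite -cap0 => p /= /allx; rewrite negbK => /asboolP.
apply: (@chromatic_number_exists _ _ _ (size s) (fun x => find (miss x) s)).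
split=> [x [_ x0]|x y [_ x0] [_ y0] [_ xy0] eq_color].
  by rewrite -has_find has_miss.
have /(nth_find set0) := has_miss x x0.
have /(nth_find set0) := has_miss y y0.
rewrite eq_color; set p := nth _ _ _ => /asboolPn npy /asboolPn npx.
have ps : p \in s by rewrite mem_nth// -has_find has_miss.
have [_ prime_p] := primes p ps.
have p0 : p 0 by have : [set 0] (0 : S) by []; rewrite -cap0; exact.
(* Every [x * s' * y] is 0, so primality would put [x] or [y] in [p], which misses both. *)
have [s'|//|//] := prime_p x y.
by rewrite -mulgA (smulC s') mulgA xy0 smul0.
Qed.

Lemma chi_finite_omega_finite : chi_finite S -> omega_finite S.
Proof.
move=> [n [[c colc] _]]; apply: (@clique_number_exists _ _ _ n) => C.
exact: clique_card_le_coloring colc.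
Qed.

Lemma omega_finite_no_infinite_clique : omega_finite S -> no_infinite_clique S.
Proof.
move=> [n [_ bound]] [C /bound Cn]; apply.
exact: card_le_finite Cn (finite_II n).
Qed.

End Implications.

Theorem theorem4p1 (S : comSemigroup0Type) (hS : reduced S) :
  (chi_finite S <-> omega_finite S) /\
  (omega_finite S <-> no_infinite_clique S) /\
  (omega_finite S <-> zero_finite_cap_primes S).
Proof.
(* The four implications form a cycle through all the conditions. *)
have chi_omega := @chi_finite_omega_finite S.
have omega_noinf := @omega_finite_no_infinite_clique S.
have noinf_primes := @no_infinite_clique_cap_primes S hS.
have primes_chi := @cap_primes_chi_finite S.
tauto.
Qed.
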